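(* Let $\kappa\in\mathbb{Z}_{\ge0}^n$ and let $J_1,\dots,J_m$ be M-convex sets on $[n]$ with corresponding rank functions $r_1,\dots,r_m$. Then there exist bases $\alpha_t\in J_t$ ($t=1,\dots,m$) such that $$\alpha_1+\cdots+\alpha_m\le\kappa$$ if and only if, for every $A\subseteq[n]$, $$\sum_{t=1}^m\big(r_t([n])-r_t(A)\big)\le\kappa([n]\setminus A).$$
   Context: Let $[n]=\{1,\dots,n\}$, let $e_i$ be the $i$-th standard basis vector, and order $\mathbb{Z}^n$ coordinatewise; $\kappa(S)=\sum_{i\in S}\kappa_i$. An M-convex set on $[n]$ of rank $r$ is a nonempty $J\subseteq\{\alpha\in\mathbb{Z}_{\ge0}^n:\alpha_1+\cdots+\alpha_n=r\}$ such that for all $\alpha,\beta\in J$ and $i\in[n]$ with $\alpha_i<\beta_i$ there is $j\in[n]$ with $\alpha_j>\beta_j$ and $\alpha+e_i-e_j,\ \beta-e_i+e_j\in J$. Its elements are called bases. The rank function of $J$ is $A\mapsto\max\{\sum_{i\in A}\alpha_i:\alpha\in J\}$ for $A\subseteq[n]$. The ranks of the $J_t$ may differ. *)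

(* Defs.v *)
From mathcomp Require Import all_boot all_order all_algebra.
From mathcomp Require Import boolp classical_sets.

Set Implicit Arguments.
Unset Strict Implicit.
Unset Printing Implicit Defensive.

Import Order.TTheory GRing.Theory Num.Theory.
Local Open Scope ring_scope.

Notation "''Zvec_' n" := {ffun 'I_n -> int}
  (at level 8, n at level 2, format "''Zvec_' n") : type_scope.

Definition stdvec n (i : 'I_n) : 'Zvec_n := [ffun k => (k == i)%:R].

Definition lecoord n (a b : 'Zvec_n) : Prop := forall i, a i <= b i.

Definition mass n (kappa : 'Zvec_n) (S : {set 'I_n}) : int :=
  \sum_(i in S) kappa i.

Definition Mconvex n (r : nat) (J : set 'Zvec_n) : Prop :=
  [/\ exists a, J a,
      forall a, J a -> lecoord 0 a /\ \sum_i a i = r%:Z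
    & forall a b, J a -> J b -> forall i, a i < b i ->
        exists j, [/\ b j < a j,
                      J (a + stdvec i - stdvec j)
                    & J (b - stdvec i + stdvec j)]].

Definition is_max_mass n (J : set 'Zvec_n) (A : {set 'I_n}) (k : int) : Prop :=
  (exists2 a, J a & mass a A = k) /\ (forall a, J a -> mass a A <= k).

(* The value is the maximum whenever one exists, as it does for every
   M-convex set by [rankfP]; the default 0 is then never used. *)
Definition rankf n (J : set 'Zvec_n) (A : {set 'I_n}) : int :=
  xget 0 (is_max_mass J A).

Lemma rankfP n r (J : set 'Zvec_n) (A : {set 'I_n}) :
  Mconvex r J -> is_max_mass J A (rankf J A).
Proof.
case=> [[a0 Ja0] Jsum _]; apply: xgetPex.
have bnd a : J a -> 0 <= mass a A <= r%:Z.
  move=> /Jsum[a_ge0 <-]; have a0i i : 0 <= a i.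
    by have := a_ge0 i; rewrite ffunE.
  rewrite /mass sumr_ge0 //= [leRHS](bigID (mem A)) /= lerDl.
  exact: sumr_ge0.
pose P (k : nat) := `[< exists2 a, J a & mass a A = k%:Z >].
have exP : exists k, P k.
  case/andP: (bnd _ Ja0) => m0 _; exists `|mass a0 A|%N.
  by apply/asboolP; exists a0 => //; rewrite gez0_abs.
have leP k : P k -> (k <= r)%N.
  by case/asboolP=> a /bnd/andP[_ ler] ka; rewrite ka in ler.
case: (ex_maxnP exP leP) => k /asboolP Pk maxk; exists k%:Z; split=> // a Ja.
case/andP: (bnd _ Ja) => m0 _; rewrite -(gez0_abs m0) lez_nat.
by apply: maxk; apply/asboolP; exists a => //; rewrite gez0_abs.
Qed.

(* Main.v *)
Require Import Defs.
From mathcomp Require Import all_boot all_order all_algebra.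
From mathcomp Require Import boolp classical_sets.
From mathcomp Require Import zify.

Set Implicit Arguments.
Unset Strict Implicit.
Unset Printing Implicit Defensive.

Import Order.TTheory GRing.Theory Num.Theory.
Local Open Scope ring_scope.

(** For an M-convex set [J] let [g_J B] be the least value of [x(B)] over
    [x] in [J].  Complementation turns [r([n]) - r(A)] into [g_J ([n] \ A)],
    so the rank condition says that [\sum_t g_(J_t) B <= kappa(B)] for every
    [B] ([demand_le]).  Necessity is then immediate, by adding up
    [g_(J_t) B <= alpha_t(B)].

    For sufficiency the sets [J_t] are shrunk, keeping the inequalities, until
    each of them is a single point; the inequalities for [B = {i}] then say
    exactly that these points sum to at most [kappa] ([packable_singletons]).
    If [J_t] has two points, some coordinate [i] is not constant on it; let [q]
    be its maximum.  Both slices [x_i < q] and [x_i >= q] of [J_t] are M-convex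
    ([slice_Mconvex]), and the point is that one of them can replace [J_t]
    ([slice_dichotomy]).  This is an uncrossing argument: if a set [B] violates
    the inequality for the lower slice and [C] for the upper one, then, by
    integrality, the two violations exceed the bound by at least 2 in total.
    Supermodularity of the functions [g_(J_s)] bounds the contribution of the
    other sets by their values on [B :|: C] and [B :&: C], whereas for [J_t]
    the passage to slices costs at most 1, because one point [x] with [x_i = q]
    minimizes the masses of [B :&: C] and [B :|: C] simultaneously, and one
    exchange step moves [x] into the lower slice.

    Both the supermodularity and the simultaneous minimizer rest on
    [chain_minimizer]: on an M-convex set the masses of two nested index sets
    attain their minima at a common point. *)

(** * Minimizers and masses *)

Lemma exists_minimizer (T : Type) (P : T -> Prop) (F : T -> int) (b : int) :
  (exists x, P x) -> (forall x, P x -> b <= F x) ->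
  exists2 x, P x & forall y, P y -> F x <= F y.
Proof.
move=> [x0 Px0] geb.
pose Q (k : nat) := `[< exists2 x, P x & F x = b + k%:Z >].
have QF x : P x -> Q `|F x - b|%N.
  by move=> Px; apply/asboolP; exists x => //; have := geb _ Px; lia.
have exQ : exists k, Q k by eexists; apply: QF Px0.
have [k /asboolP[x Px Fx] mink] := ex_minnP exQ.
by exists x => // y Py; have := mink _ (QF y Py); have := geb y Py; lia.
Qed.

Section Mass.
Variable n : nat.
Implicit Types (a b x y : 'Zvec_n) (A B : {set 'I_n}).

Lemma massD a b A : mass (a + b) A = mass a A + mass b A.
Proof. by rewrite /mass -big_split; apply: eq_bigr => k _; rewrite ffunE. Qed.

Lemma massN a A : mass (- a) A = - mass a A.
Proof. by rewrite /mass -sumrN; apply: eq_bigr => k _; rewrite ffunE. Qed.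

Lemma mass_stdvec i A : mass (stdvec i) A = (i \in A)%:R.
Proof.
rewrite /mass; case: (boolP (i \in A)) => iA.
  rewrite (bigD1 i) //= big1 => [|k /andP[_ /negPf ki]]; rewrite ffunE ?ki //.
  by rewrite eqxx addr0.
by rewrite big1 // => k kA; rewrite ffunE; case: eqP kA iA => // -> ->.
Qed.

Definition massE := (massD, massN, mass_stdvec).

Lemma mass_sum (I : finType) (a : I -> 'Zvec_n) A :
  mass (\sum_t a t) A = \sum_t mass (a t) A.
Proof.
rewrite /mass exchange_big /=; apply: eq_bigr => k _.
by rewrite sum_ffunE.
Qed.

Lemma massUI x A B : mass x (A :|: B) + mass x (A :&: B) = mass x A + mass x B.
Proof.
rewrite /mass ![\sum_(i in _) _]big_mkcond -!big_split; apply: eq_bigr => k _.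
by rewrite !inE; case: (k \in A); case: (k \in B); rewrite /= ?addr0 ?add0r.
Qed.

Lemma massC x A : mass x (~: A) = mass x [set: 'I_n] - mass x A.
Proof.
have := massUI x A (~: A); rewrite finset.setUCr finset.setICr {2}/mass big_set0; lia.
Qed.

End Mass.

(** * Exchange in M-convex sets *)

Definition l1dist n (x y : 'Zvec_n) : nat := (\sum_k absz (x k - y k)%R)%N.

Lemma exchange_l1dist_lt n (x y : 'Zvec_n) i j : x i < y i -> y j < x j ->
  (l1dist x (y - stdvec i + stdvec j)%R < l1dist x y)%N.
Proof.
move=> xyi yxj; rewrite /l1dist (bigD1 i) // [ltnRHS](bigD1 i) //=.
rewrite -addSn; apply: leq_add; last apply: leq_sum => k /negPf ki.
all: rewrite !ffunE ?eqxx ?ki; case: eqP => [ij|_] /=; rewrite ?ij in xyi *; lia.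
Qed.

Section Mconvex.
Variables (n r : nat) (J : set 'Zvec_n).
Hypothesis J_Mconvex : Mconvex r J.
Implicit Types (a b x y : 'Zvec_n) (A B : {set 'I_n}).

Lemma Mconvex_ge0 x k : J x -> 0 <= x k.
Proof.
by case: J_Mconvex => _ Jsum _ /Jsum[/(_ k) + _]; rewrite ffunE.
Qed.

Lemma Mconvex_mass_setT x : J x -> mass x [set: 'I_n] = r%:Z.
Proof.
case: J_Mconvex => _ Jsum _ /Jsum[_ <-].
by apply: eq_bigl => k; rewrite inE.
Qed.

Lemma Mconvex_mass_ge0 x A : J x -> 0 <= mass x A.
Proof. by move=> Jx; apply: sumr_ge0 => k _; apply: Mconvex_ge0. Qed.

Lemma Mconvex_le_rank x k : J x -> x k <= r%:Z.
Proof.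
move=> Jx; rewrite -(Mconvex_mass_setT Jx) /mass (bigD1 k) ?inE //= lerDl.
by apply: sumr_ge0 => l _; apply: Mconvex_ge0.
Qed.

Lemma Mconvex_exists : exists x, J x.
Proof. by case: J_Mconvex. Qed.

Lemma Mconvex_exchange a b i : J a -> J b -> a i < b i ->
  exists j, [/\ b j < a j, J (a + stdvec i - stdvec j)
                         & J (b - stdvec i + stdvec j)].
Proof. by case: J_Mconvex => _ _ exch Ja Jb; apply: exch. Qed.

(** All points have the same coordinate sum, so distinct points are never
    comparable; this provides the coordinate at which to start an exchange. *)
Lemma Mconvex_neq_lt a b : J a -> J b -> a != b -> exists i, a i < b i.
Proof.
move=> Ja Jb; apply: contraNP => /forallNP nlt.
have leba k : b k <= a k by rewrite leNgt; apply/negP.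
have: \sum_k (a k - b k) == 0.
  case: J_Mconvex => _ Jsum _; rewrite sumrB.
  by have [_ ->] := Jsum _ Ja; have [_ ->] := Jsum _ Jb; rewrite subrr.
rewrite psumr_eq0 => [/allP eqab | k _]; last by rewrite subr_ge0.
apply/eqP/ffunP => k; apply/eqP; rewrite -subr_eq0.
by apply: eqab; rewrite mem_index_enum.
Qed.

(** A minimizer [x] of [mass x A + mass x B] works.  By minimality, an exchange
    moving [x] towards [y] cannot raise a coordinate lying in fewer of the
    nested sets [A], [B] than the coordinate it lowers.  The opposite step at
    [y] therefore increases neither mass of [y] and brings [y] closer to [x];
    repeating it ends at [x]. *)
Lemma chain_minimizer A B : A \subset B -> exists x,
  [/\ J x, forall y, J y -> mass x A <= mass y A
         & forall y, J y -> mass x B <= mass y B].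
Proof.
move=> /fintype.subsetP sAB.
have [|x Jx minx] := @exists_minimizer _ J (fun x => mass x A + mass x B) 0
  Mconvex_exists.
  by move=> x Jx; rewrite addr_ge0 ?Mconvex_mass_ge0.
suff H y : J y -> mass x A <= mass y A /\ mass x B <= mass y B.
  by exists x; split=> // y /H[].
have [N] := ubnP (l1dist x y); elim: N y => // N IH y ltN Jy.
have [-> //|neq] := eqVneq x y.
have [i xyi] := Mconvex_neq_lt Jx Jy neq.
have [j [yxj Jx' Jy']] := Mconvex_exchange Jx Jy xyi.
have [|+ +] := IH _ _ Jy'.
  exact: leq_trans (exchange_l1dist_lt xyi yxj) _.
have := minx _ Jx'; rewrite !massE.
have := sAB i; have := sAB j.
by case: (i \in A); case: (j \in A); case: (i \in B); case: (j \in B);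
  move=> /= P1 P2; first [lia | have := P1 isT | have := P2 isT].
Qed.

End Mconvex.

(** * The supermodular function of an M-convex set *)

(** The minimum of [mass x B] over [x] in [J]; all bases have the same total
    mass, so minimizing on [B] amounts to maximizing on its complement. *)
Definition minmass n (J : set 'Zvec_n) (B : {set 'I_n}) : int :=
  rankf J [set: 'I_n] - rankf J (~: B).

Section Minmass.
Variables (n r : nat) (J : set 'Zvec_n).
Hypothesis J_Mconvex : Mconvex r J.
Implicit Types (x : 'Zvec_n) (A B : {set 'I_n}).

Lemma mass_rankf_setC x B :
  J x -> mass x B = rankf J [set: 'I_n] - mass x (~: B).
Proof.
move=> Jx; rewrite massC opprB addrCA (_ : rankf _ _ = mass x [set: _]).
  by rewrite subrr addr0.
have [[a Ja <-] _] := rankfP [set: 'I_n] J_Mconvex.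
by rewrite !(Mconvex_mass_setT J_Mconvex).
Qed.

Lemma minmass_le x B : J x -> minmass J B <= mass x B.
Proof.
move=> Jx; rewrite (mass_rankf_setC _ Jx) lerD2l lerN2.
by have [_ ->] := rankfP (~: B) J_Mconvex.
Qed.

Lemma minmass_attained B : exists2 x, J x & mass x B = minmass J B.
Proof.
have [[x Jx eqx] _] := rankfP (~: B) J_Mconvex.
by exists x; rewrite // (mass_rankf_setC _ Jx) eqx.
Qed.

Lemma minmass_chain A B : exists x,
  [/\ J x, mass x (A :&: B) = minmass J (A :&: B)
         & mass x (A :|: B) = minmass J (A :|: B)].
Proof.
have [|x [Jx minI minU]] := @chain_minimizer _ _ _ J_Mconvex (A :&: B) (A :|: B).
  exact: fintype.subset_trans (finset.subsetIl _ _) (finset.subsetUl _ _).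
exists x; split=> //; apply/eqP; rewrite eq_le minmass_le ?andbT //.
  by have [y Jy <-] := minmass_attained (A :&: B); apply: minI.
by have [y Jy <-] := minmass_attained (A :|: B); apply: minU.
Qed.

(** A common minimizer for the intersection and the union turns the right-hand
    side into the modular expression [mass x A + mass x B]. *)
Lemma minmass_supermodular A B :
  minmass J A + minmass J B <= minmass J (A :|: B) + minmass J (A :&: B).
Proof.
have [x [Jx <- <-]] := minmass_chain A B.
by rewrite massUI lerD ?minmass_le.
Qed.

End Minmass.

(** * Slicing an M-convex set along a coordinate *)

Definition slice n (J : set 'Zvec_n) (i : 'I_n) (P : pred int) : set 'Zvec_n :=
  [set x | J x /\ P (x i)]%classic.

Definition order_convex (P : pred int) : Prop :=
  forall u v w, P u -> P w -> u <= v <= w -> P v.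

(** In an exchange between [a] and [b], the [i]-th coordinates of the two new
    points stay between [a i] and [b i], so the same exchange is available in
    the slice. *)
Lemma slice_Mconvex n r (J : set 'Zvec_n) i (P : pred int) :
  Mconvex r J -> order_convex P -> (exists2 x, J x & P (x i)) ->
  Mconvex r (slice J i P).
Proof.
move=> Jr Pconv [x0 Jx0 Px0]; have [_ Jsum _] := Jr.
split=> [|a [/Jsum //]|a b [Ja Pa] [Jb Pb] k abk]; first by exists x0.
have [j [baj Ja' Jb']] := Mconvex_exchange Jr Ja Jb abk.
have between x : a i <= x <= b i \/ b i <= x <= a i -> P x.
  by case; apply: Pconv.
by exists j; split=> //; split=> //; apply: between; rewrite !ffunE;
  case: (eqVneq i k) => [ik|_]; case: (eqVneq i j) => [ij|_];
  rewrite -?ik -?ij /= in abk baj *; lia.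
Qed.

(** The submodular bound [c] stands for what [kappa] leaves over once the
    demands of the other M-convex sets are subtracted.  Suppose [B] defeats the
    lower slice and [C] the upper one.  A point [x] minimizing the masses of
    both [B :&: C] and [B :|: C] can be taken with [x i = q]; it then lies in
    the upper slice, so [c C + 1 <= mass x C], and one exchange step puts it in
    the lower slice, so [c B + 1 <= mass x B + 1].  Since
    [mass x B + mass x C] equals the sum of the two minima, which is at most
    [c (B :|: C) + c (B :&: C)], this contradicts the submodularity of [c]. *)
Lemma slice_dichotomy n r (J : set 'Zvec_n) (c : {set 'I_n} -> int) i q :
  Mconvex r J ->
  (forall A B, c (A :|: B) + c (A :&: B) <= c A + c B) ->
  (forall B, minmass J B <= c B) ->
  (exists2 x, J x & x i = q) -> (forall x, J x -> x i <= q) ->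
  (exists2 x, J x & x i < q) ->
  (forall B, minmass (slice J i (< q)) B <= c B) \/
  (forall B, minmass (slice J i (>= q)) B <= c B).
Proof.
move=> Jr csub Jc [z Jz zq] leq [w Jw wq].
have lo_Mconvex : Mconvex r (slice J i (< q)).
  apply: (slice_Mconvex Jr); last by exists w.
  by move=> u v s /=; lia.
have hi_Mconvex : Mconvex r (slice J i (>= q)).
  apply: (slice_Mconvex Jr); last by exists z; rewrite //= zq.
  by move=> u v s /=; lia.
apply: contrapT => /not_orP[] /existsNP[B loB] /existsNP[C hiC].
have {}loB x : J x -> x i < q -> c B < mass x B.
  move=> Jx xq; have := @minmass_le _ _ _ lo_Mconvex x B (conj Jx xq); lia.
have {}hiC x : J x -> q <= x i -> c C < mass x C.
  move=> Jx xq; have := @minmass_le _ _ _ hi_Mconvex x C (conj Jx xq); lia.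
pose chainmin x := [/\ J x, mass x (B :&: C) = minmass J (B :&: C)
                          & mass x (B :|: C) = minmass J (B :|: C)].
have [||x [Jx xI xU] maxx] := @exists_minimizer _ chainmin (fun x => - x i) (- q).
- exact: minmass_chain Jr B C.
- by move=> x [/leq]; rewrite lerN2.
(* Otherwise exchange [x] against a minimizer [y] for [B].  As [y] drops into
   the lower slice, its mass on [B] must grow, so the step raises at [x] a
   coordinate outside [B] and lowers one inside [B].  This keeps [x] a common
   minimizer but increases [x i], against the choice of [x]. *)
have xq : q <= x i.
  have [y Jy yB] := minmass_attained Jr B.
  rewrite leNgt; apply/negP => xq.
  have xyi : x i < y i.
    have := Jc B; have := loB y Jy; lia.
  have [j [yxj Jx' Jy']] := Mconvex_exchange Jr Jx Jy xyi.
  have ij : i != j by apply/eqP => ij; rewrite -ij in yxj; lia.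
  have := loB _ Jy'; rewrite !ffunE eqxx (negPf ij) !massE yB /= => lo.
  have {}lo := lo ltac:(have := leq _ Jy; lia).
  have := Jc B => JcB.
  have [iB jB] : i \notin B /\ j \in B.
    by move: lo; case: (i \in B); case: (j \in B) => //=; lia.
  have: chainmin (x + stdvec i - stdvec j).
    split=> //; [have := minmass_le Jr (B :&: C) Jx' | have := minmass_le Jr (B :|: C) Jx'].
      by rewrite !massE !inE (negPf iB) jB xI /=; lia.
    by rewrite !massE !inE jB xU /=; lia.
  by move/maxx; rewrite !ffunE eqxx (negPf ij) /=; lia.
have [j [xwj _ Jx']] := Mconvex_exchange Jr Jw Jx (lt_le_trans wq xq).
have ij : i != j by apply/eqP => ij; rewrite -ij in xwj; lia.
have := loB _ Jx'; rewrite !ffunE eqxx (negPf ij) !massE /= => lo.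
have {}lo := lo ltac:(have := leq _ Jx; lia).
have := hiC _ Jx xq; have := massUI x B C; have := csub B C.
have := Jc (B :|: C); have := Jc (B :&: C); rewrite xI xU.
by move: lo; case: (i \in B); case: (j \in B) => /=; lia.
Qed.

(** * Shrinking the family to single points *)

(** A size that decreases under slicing: the points of an M-convex set of rank
    [r] all lie in the box [{0, ..., r}^n], where they can be counted. *)
Definition box_card n r (J : set 'Zvec_n) : nat :=
  #|[pred f : {ffun 'I_n -> 'I_r.+1} | `[< J [ffun k => (f k : nat)%:Z] >]]|.

Lemma box_card_lt n r (J J' : set 'Zvec_n) x :
  Mconvex r J -> (J' `<=` J)%classic -> J x -> ~ J' x ->
  (box_card r J' < box_card r J)%N.
Proof.
move=> Jr sJ'J Jx J'x; apply/proper_card/properP; split.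
  by apply/fintype.subsetP => f; rewrite !inE => /sJ'J.
pose f := [ffun k => inord `|x k|%N] : {ffun 'I_n -> 'I_r.+1}.
have fx : [ffun k => (f k : nat)%:Z] = x.
  apply/ffunP => k; have xk0 := Mconvex_ge0 Jr k Jx.
  have := Mconvex_le_rank Jr k Jx; rewrite !ffunE -{1}(gez0_abs xk0) => xkr.
  by rewrite inordK ?gez0_abs // ltnS -lez_nat.
by exists f; rewrite !inE fx //; apply/asboolP.
Qed.

Section Packing.
Variables (n m : nat) (kappa : 'Zvec_n) (d : 'I_m -> nat).
Implicit Types (J : 'I_m -> set 'Zvec_n) (B : {set 'I_n}).

Definition packable J :=
  exists alpha : 'I_m -> 'Zvec_n,
    (forall t, J t (alpha t)) /\ lecoord (\sum_t alpha t) kappa.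

(** The rank condition, with [B] the complement of [A]. *)
Definition demand_le J :=
  forall B, \sum_t minmass (J t) B <= mass kappa B.

Lemma packable_demand_le J :
  (forall t, Mconvex (d t) (J t)) -> packable J -> demand_le J.
Proof.
move=> Jd [alpha [Jalpha lek]] B.
apply: (@le_trans _ _ (mass (\sum_t alpha t) B)); last exact: ler_sum.
by rewrite mass_sum; apply: ler_sum => t _; apply: minmass_le (Jd t) _ _ _.
Qed.

Lemma packable_singletons J :
  (forall t, Mconvex (d t) (J t)) ->
  (forall t x y, J t x -> J t y -> x = y) ->
  demand_le J -> packable J.
Proof.
move=> Jd Juniq Jdem.
have [alpha Jalpha] := choice (fun t => Mconvex_exists (Jd t)).
exists alpha; split=> // i; have := Jdem [set i].
rewrite /mass big_set1 sum_ffunE; congr (_ <= _); apply: eq_bigr => t _.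
have [x Jx <-] := minmass_attained (Jd t) [set i].
by rewrite /mass big_set1 (Juniq t x (alpha t)).
Qed.

Definition slice_family J t i P : 'I_m -> set 'Zvec_n :=
  fun s => if s == t then slice (J t) i P else J s.

Lemma slice_family_step J t i x y :
  (forall s, Mconvex (d s) (J s)) -> demand_le J ->
  J t x -> J t y -> x i < y i ->
  exists P, [/\ order_convex P, demand_le (slice_family J t i P),
                exists2 x, J t x & P (x i) & exists2 x, J t x & ~~ P (x i)].
Proof.
move=> Jd Jdem Jx Jy xy.
have [||w Jw maxw] := @exists_minimizer _ (J t) (fun z => - z i) (- (d t)%:Z).
- exact: Mconvex_exists (Jd t).
- by move=> z /(Mconvex_le_rank (Jd t) i); rewrite lerN2.
have {}maxw z : J t z -> z i <= w i by move/maxw; rewrite lerN2.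
have xw : x i < w i by apply: lt_le_trans xy (maxw _ Jy).
pose c B := mass kappa B - \sum_(s | s != t) minmass (J s) B.
have dem P : (forall B, minmass (slice (J t) i P) B <= c B) ->
    demand_le (slice_family J t i P).
  move=> lec B; rewrite (bigD1 t) //= {1}/slice_family eqxx -lerBrDr.
  apply: le_trans (lec B) _; rewrite /c lerD2l lerN2 le_eqVlt.
  apply/orP; left; apply/eqP; apply: eq_bigr => s /negPf st.
  by rewrite /slice_family st.
have [|||||lo|hi] := @slice_dichotomy _ _ _ c i (w i) (Jd t).
- move=> A B; rewrite /c.
  have := massUI kappa A B.
  have : \sum_(s | s != t) (minmass (J s) A + minmass (J s) B) <=
      \sum_(s | s != t) (minmass (J s) (A :|: B) + minmass (J s) (A :&: B)).
    by apply: ler_sum => s _; apply: minmass_supermodular (Jd s) A B.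
  by rewrite !big_split /=; lia.
- by move=> B; have := Jdem B; rewrite (bigD1 t) //= -lerBrDr.
- by exists w.
- exact: maxw.
- by exists x.
- exists (< w i); split; first by move=> u v s /=; lia.
  + exact: dem.
  + by exists x.
  + by exists w; rewrite //= ltxx.
- exists (>= w i); split; first by move=> u v s /=; lia.
  + exact: dem.
  + by exists w => /=.
  + by exists x; rewrite //= -ltNge.
Qed.

(** Each slicing step removes a point from one member of the family, and a
    packing of the sliced family is also one of the original family. *)
Lemma demand_le_packable J :
  (forall t, Mconvex (d t) (J t)) -> demand_le J -> packable J.
Proof.
have [N] := ubnP (\sum_t box_card (d t) (J t)).
elim: N J => // N IH J ltN Jd Jdem.
have [[t [x [y [Jx Jy xy]]]]|eqJ] :=
  pselect (exists t x y, [/\ J t x, J t y & x != y]); last first.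
  apply: packable_singletons => // t x y Jx Jy; apply/eqP/negPn/negP => xy.
  by apply: eqJ; exists t, x, y.
have [i xyi] := Mconvex_neq_lt (Jd t) Jx Jy xy.
have [P [Pconv dem exP [z Jz nPz]]] := slice_family_step Jd Jdem Jx Jy xyi.
have [| s | alpha [Jalpha lek]] := IH (slice_family J t i P) _ _ dem.
- rewrite -ltnS; apply: leq_trans ltN; rewrite ltnS.
  rewrite (bigD1 t) //= [ltnRHS](bigD1 t) //= -addSn /slice_family eqxx.
  apply: leq_add; first apply: box_card_lt (Jd t) _ Jz _.
  + by move=> u [].
  + by case=> _ Pz; rewrite Pz in nPz.
  by apply: leq_sum => s /negPf ->.
- by rewrite /slice_family; case: eqP => [->|//]; apply: slice_Mconvex.
exists alpha; split=> // s; have := Jalpha s.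
by rewrite /slice_family; case: eqP => [->|//] [].
Qed.

End Packing.

Theorem theorem4p16 (n m : nat) (kappa : 'Zvec_n) (kappa_ge0 : lecoord 0 kappa)
    (d : 'I_m -> nat) (J : 'I_m -> set 'Zvec_n)
    (J_Mconvex : forall t, Mconvex (d t) (J t)) :
  (exists alpha : 'I_m -> 'Zvec_n,
      (forall t, J t (alpha t)) /\ lecoord (\sum_t alpha t) kappa)
  <->
  (forall A : {set 'I_n},
      \sum_t (rankf (J t) [set: 'I_n] - rankf (J t) A)
        <= mass kappa ([set: 'I_n] :\: A)).
Proof.
apply: (iff_trans (B := demand_le kappa J)); split.
- exact: packable_demand_le J_Mconvex.
- exact: demand_le_packable J_Mconvex.
- by move=> dem A; have := dem (~: A); rewrite /minmass finset.setCK finset.setTD.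
- by move=> dem B; have := dem (~: B); rewrite finset.setTD finset.setCK.
Qed.
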